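(* Let $\omega=e^{2\pi i/3}$. Consider a pair $(C,D)\in\mathfrak{O}$ equivalent to $(I_3,\operatorname{diag}(\lambda_1,\lambda_2,\lambda_3))$. If the point $[\lambda_1:\lambda_2:\lambda_3]$ in $\mathbb{CP}^2/S_3$ is different from $[1:\omega:\omega^2]$, then the isotropy group of $(C,D)$ in $G=\mathbb{P}GL_3(\mathbb{C})$ is isomorphic to the Klein four-group $V_4$. At $(I_3,\operatorname{diag}(1,\omega,\omega^2))$, the isotropy group has $12$ elements and is isomorphic to $V_4\ltimes_\Phi\mathbb{Z}_3$.
   Context: A conic in $\mathbb{CP}^2$ is identified with its symmetric $3\times 3$ complex matrix up to a non-zero scalar. $\mathfrak{O}\subset\mathbb{CP}^5\times\mathbb{CP}^5$ is the set of pairs $(C,D)$ of non-degenerate conics that intersect transversely, i.e. in four distinct points. $G=\mathbb{P}GL_3(\mathbb{C})$ acts on $\mathfrak{O}$ by congruence: $A$ sends $(C,D)$ to $(A^TCA,A^TDA)$ (each entry taken up to a non-zero scalar); two pairs are equivalent if they lie in the same $G$-orbit. $S_3$ acts on $\mathbb{CP}^2$ by permuting coordinates. Here $V_4$ is realized as the group of matrices $\operatorname{diag}(a_1,a_2,a_3)$, $a_i\in\{1,-1\}$, modulo $\pm I_3$, and $\mathbb{Z}_3$ as the subgroup $\{\mathrm{Id},(123),(132)\}$ of $S_3$. The map $\Phi:\mathbb{Z}_3\to\operatorname{Aut}(V_4)$ is $\Phi(\sigma)(\operatorname{diag}(a_1,a_2,a_3))=\operatorname{diag}(a_{\sigma(1)},a_{\sigma(2)},a_{\sigma(3)})$,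 and the product in $V_4\ltimes_\Phi\mathbb{Z}_3$ is $(\Lambda,\sigma_1)\cdot(\Lambda',\sigma_2)=(\Phi(\sigma_2)(\Lambda)\Lambda',\sigma_1\sigma_2)$. *)

(* Defs.v *)
From HB Require Import structures.
From mathcomp Require Import all_boot all_order all_algebra fingroup perm.
From mathcomp Require Import ring.
From mathcomp Require Import all_classical all_reals all_analysis.
From mathcomp Require Import complex.
(* [fingroup] and [generic_quotient] both define [repr]; the latter is meant. *)
From mathcomp Require Import generic_quotient.

Set Implicit Arguments.
Unset Strict Implicit.
Unset Printing Implicit Defensive.

Import GRing.Theory.
Local Open Scope quotient_scope.
Local Open Scope ring_scope.

Section QuotientGroup.
Local Open Scope group_scope.

Record normal_subgroup (G : groupType) := NormalSubgroup {
  nsub :> {pred G};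
  nsub_closed : group_closed nsub;
  nsub_conj : forall x y : G, x \in nsub -> x ^ y \in nsub }.

Context (G : groupType) (N : normal_subgroup G).

Definition coset_rel (x y : G) : bool := x / y \in nsub N.

Let N1 : 1 \in nsub N. Proof. by case: (nsub_closed N). Qed.
Let NF x y : x \in nsub N -> y \in nsub N -> x / y \in nsub N.
Proof. by case: (nsub_closed N) => _; apply. Qed.
Let NV x : x \in nsub N -> x^-1 \in nsub N.
Proof. by move=> Nx; rewrite -[x^-1]mul1g; apply: NF. Qed.
Let NM x y : x \in nsub N -> y \in nsub N -> x * y \in nsub N.
Proof. by move=> Nx Ny; rewrite -[y]invgK; apply: NF => //; apply: NV. Qed.

Let coset_rel_refl : reflexive coset_rel.
Proof. by move=> x; rewrite /coset_rel mulgV. Qed.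
Let coset_rel_sym : symmetric coset_rel.
Proof. by move=> x y; apply/idP/idP => /NV; rewrite invgF. Qed.
Let coset_rel_trans : transitive coset_rel.
Proof. by move=> y x z xy yz; have := NM xy yz; rewrite mulgA mulgVK. Qed.

Canonical coset_rel_equiv :=
  EquivRel coset_rel coset_rel_refl coset_rel_sym coset_rel_trans.

Definition quotient_group := {eq_quot coset_rel}.
HB.instance Definition _ := Choice.on quotient_group.
HB.instance Definition _ := EqQuotient.on quotient_group.

Lemma quotient_groupP (x y : G) :
  reflect (x = y %[mod quotient_group]) (x / y \in nsub N).
Proof.
apply: (iffP idP) => [Nxy|/eqP]; last by rewrite eqmodE.
by apply/eqP; rewrite eqmodE.
Qed.

Definition quot_one : quotient_group := \pi_quotient_group 1.
Definition quot_mul (a b : quotient_group) : quotient_group :=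
  \pi_quotient_group (repr a * repr b).
Definition quot_inv (a : quotient_group) : quotient_group :=
  \pi_quotient_group (repr a)^-1.

Lemma quot_mulE x y :
  quot_mul (\pi_quotient_group x) (\pi_quotient_group y)
  = \pi_quotient_group (x * y).
Proof.
apply/quotient_groupP.
have /quotient_groupP Nx : repr (\pi_quotient_group x) = x %[mod quotient_group].
  by rewrite reprK.
have /quotient_groupP Ny : repr (\pi_quotient_group y) = y %[mod quotient_group].
  by rewrite reprK.
move: (repr _) (repr _) Nx Ny => y' x' Nx Ny.
have -> : x' * y' / (x * y) = (y' / y) ^ x'^-1 * (x' / x).
  by rewrite conjgE invgK invgM !mulgA !mulgVK.
by apply: NM => //; apply: nsub_conj.
Qed.

Lemma quot_invE x :
  quot_inv (\pi_quotient_group x) = \pi_quotient_group x^-1.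
Proof.
apply/quotient_groupP.
have /quotient_groupP : x = repr (\pi_quotient_group x) %[mod quotient_group].
  by rewrite reprK.
move: (repr _) => x' /(nsub_conj x').
by rewrite conjgE !mulgA mulgVK invgK.
Qed.

Let piW (P : quotient_group -> Prop) :
  (forall x, P (\pi_quotient_group x)) -> forall a, P a.
Proof. by move=> Ppi a; rewrite -[a]reprK. Qed.

Let quot_mulA : associative quot_mul.
Proof.
elim/piW => x; elim/piW => y; elim/piW => z.
by rewrite !quot_mulE mulgA.
Qed.
Let quot_mul1 : left_id quot_one quot_mul.
Proof. by elim/piW => x; rewrite quot_mulE mul1g. Qed.
Let quot_1mul : right_id quot_one quot_mul.
Proof. by elim/piW => x; rewrite quot_mulE mulg1. Qed.
Let quot_mulV : left_inverse quot_one quot_inv quot_mul.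
Proof. by elim/piW => x; rewrite quot_invE quot_mulE mulVg. Qed.
Let quot_Vmul : right_inverse quot_one quot_inv quot_mul.
Proof. by elim/piW => x; rewrite quot_invE quot_mulE mulgV. Qed.

HB.instance Definition _ := isGroup.Build quotient_group
  quot_mulA quot_mul1 quot_1mul quot_mulV quot_Vmul.

Lemma pi_quotientM :
  {morph \pi_quotient_group : x y / (x * y)%g >-> (x * y)%g}.
Proof. by move=> x y; rewrite -quot_mulE. Qed.

End QuotientGroup.

Definition isomorphic_groups (G H : groupType) : Prop :=
  exists f : {multiplicative G -> H}, bijective f.

Section ProjectiveSpace.
Context (F : fieldType) (V : lmodType F).

Record nonzero := Nonzero { nonzero_val : V; _ : nonzero_val != 0 }.
HB.instance Definition _ := [isSub for nonzero_val].
HB.instance Definition _ := [Choice of nonzero by <:].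

Definition proportional (u v : nonzero) : bool :=
  `[< exists2 c : F, c != 0 & val u = c *: val v >].

Let proportional_refl : reflexive proportional.
Proof. by move=> u; apply/asboolP; exists 1; rewrite ?oner_neq0 ?scale1r. Qed.
Let proportional_sym : symmetric proportional.
Proof.
suff sub u v : proportional u v -> proportional v u.
  by move=> u v; apply/idP/idP; apply: sub.
move=> /asboolP[c c0 uv]; apply/asboolP; exists c^-1; first by rewrite invr_eq0.
by rewrite uv scalerA mulVf // scale1r.
Qed.
Let proportional_trans : transitive proportional.
Proof.
move=> v u w /asboolP[c c0 uv] /asboolP[d d0 vw]; apply/asboolP.
by exists (c * d); rewrite ?mulf_neq0 // uv vw scalerA.
Qed.

Canonical proportional_equiv :=
  EquivRel proportional proportional_refl proportional_sym proportional_trans.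

Definition proj_space := {eq_quot proportional}.
HB.instance Definition _ := Choice.on proj_space.
HB.instance Definition _ := EqQuotient.on proj_space.

Definition proj_point (v : nonzero) : proj_space := \pi_proj_space v.

Lemma proj_point_surj (p : proj_space) : exists v, p = proj_point v.
Proof. by exists (repr p); rewrite /proj_point reprK. Qed.

Lemma proj_pointP (u v : nonzero) :
  reflect (exists2 c : F, c != 0 & val u = c *: val v)
          (proj_point u == proj_point v).
Proof. by rewrite eqmodE; apply: asboolP. Qed.

Lemma repr_proj_point (v : nonzero) :
  exists2 c : F, c != 0 & val (repr (proj_point v)) = c *: val v.
Proof. by apply/proj_pointP; rewrite /proj_point reprK. Qed.

End ProjectiveSpace.

Section PGL3.
Context (F : fieldType).

Record GL3 := MkGL3 { GL3_val :> 'M[F]_3; _ : GL3_val \in unitmx }.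
HB.instance Definition _ := [isSub for GL3_val].
HB.instance Definition _ := [Choice of GL3 by <:].

Definition GL3_one : GL3 := MkGL3 (unitmx1 F 3).
Lemma GL3_mul_subproof (A B : GL3) : A *m B \in unitmx.
Proof. by rewrite unitmx_mul (valP A) (valP B). Qed.
Definition GL3_mul (A B : GL3) : GL3 := MkGL3 (GL3_mul_subproof A B).
Lemma GL3_inv_subproof (A : GL3) : invmx A \in unitmx.
Proof. by rewrite unitmx_inv (valP A). Qed.
Definition GL3_inv (A : GL3) : GL3 := MkGL3 (GL3_inv_subproof A).

Let GL3_mulA : associative GL3_mul.
Proof. by move=> A B C; apply/val_inj; rewrite /= mulmxA. Qed.
Let GL3_mul1 : left_id GL3_one GL3_mul.
Proof. by move=> A; apply/val_inj; rewrite /= mul1mx. Qed.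
Let GL3_1mul : right_id GL3_one GL3_mul.
Proof. by move=> A; apply/val_inj; rewrite /= mulmx1. Qed.
Let GL3_mulV : left_inverse GL3_one GL3_inv GL3_mul.
Proof. by move=> A; apply/val_inj; rewrite /= mulVmx ?(valP A). Qed.
Let GL3_Vmul : right_inverse GL3_one GL3_inv GL3_mul.
Proof. by move=> A; apply/val_inj; rewrite /= mulmxV ?(valP A). Qed.

HB.instance Definition _ :=
  isGroup.Build GL3 GL3_mulA GL3_mul1 GL3_1mul GL3_mulV GL3_Vmul.

Definition GL3_scalar := [pred A : GL3 | is_scalar_mx A].

Lemma GL3_scalar_closed : group_closed GL3_scalar.
Proof.
split=> [|A B]; first exact: scalar_mx_is_scalar.
rewrite !inE => /is_scalar_mxP[a Aa] /is_scalar_mxP[b Bb].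
apply/is_scalar_mxP; exists (a * b^-1).
by rewrite /= Aa Bb invmx_scalar -scalar_mxM.
Qed.

Lemma GL3_scalar_conj (A B : GL3) :
  A \in GL3_scalar -> (A ^ B)%g \in GL3_scalar.
Proof.
rewrite !inE => /is_scalar_mxP[a Aa]; apply/is_scalar_mxP; exists a.
by rewrite /= Aa -scalar_mxC mulmxA mulVmx ?mul1mx ?(valP B).
Qed.

Definition PGL3 :=
  quotient_group (NormalSubgroup GL3_scalar_closed GL3_scalar_conj).
HB.instance Definition _ := Group.on PGL3.
HB.instance Definition _ := EqQuotient.on PGL3.

Lemma PGL3P (A B : GL3) :
  reflect (exists2 c : F, c != 0 & val A = c *: val B)
          (\pi_PGL3 A == \pi_PGL3 B).
Proof.
rewrite eqmodE; apply: (iffP idP) => [/is_scalar_mxP[c ABc]|[c c0 AcB]].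
  have AcB : val A = c *: val B.
    by rewrite -mul_scalar_mx -ABc /= -mulmxA mulVmx ?mulmx1 ?(valP B).
  exists c => //; apply: contraTneq (valP A) => c0.
  by rewrite AcB c0 scale0r unitmxE det0 unitr0.
apply/is_scalar_mxP; exists c.
by rewrite /= AcB -scalemxAl mulmxV ?scalemx1 ?(valP B).
Qed.

Lemma repr_PGL3 (A : GL3) :
  exists2 c : F, c != 0 & val (repr (\pi_PGL3 A)) = c *: val A.
Proof. by apply/PGL3P; rewrite reprK. Qed.

End PGL3.

Section Conics.
Context (F : fieldType).

Record symmx := Symmx { symmx_val :> 'M[F]_3; _ : symmx_val^T == symmx_val }.
HB.instance Definition _ := [isSub for symmx_val].
HB.instance Definition _ := [Choice of symmx by <:].

Lemma symmx_closed : subsemimod_closed [pred A : 'M[F]_3 | A^T == A].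
Proof.
split; first split=> [|A B]; rewrite ?inE ?trmx0 //.
  by move=> /eqP sA /eqP sB; rewrite raddfD /= sA sB.
by move=> a A; rewrite !inE => /eqP sA; rewrite linearZ /= sA.
Qed.
HB.instance Definition _ :=
  GRing.SubChoice_isSubLmodule.Build F 'M[F]_3 _ symmx symmx_closed.

Definition CP2 := proj_space 'rV[F]_3.
Definition conic := proj_space symmx.

Definition vec (v : nonzero 'rV[F]_3) : 'rV[F]_3 := val v.
Definition mx (M : nonzero symmx) : 'M[F]_3 := val (val M).

Lemma repr_CP2 (v : nonzero 'rV[F]_3) :
  exists2 c : F, c != 0 & vec (repr (proj_point v)) = c *: vec v.
Proof. exact: repr_proj_point. Qed.

Lemma repr_conic (M : nonzero symmx) :
  exists2 c : F, c != 0 & mx (repr (proj_point M)) = c *: mx M.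
Proof.
by have [c c0 /(congr1 val)] := repr_proj_point M; exists c.
Qed.

(* The predicates and operations on classes below are computed on the canonical
   representatives; each is followed by the lemma stating its value on the
   class of an arbitrary representative. *)

Definition on_conic (C : conic) (p : CP2) : bool :=
  vec (repr p) *m mx (repr C) *m (vec (repr p))^T == 0.

Lemma on_conicE (M : nonzero symmx) (v : nonzero 'rV[F]_3) :
  on_conic (proj_point M) (proj_point v)
  = (vec v *m mx M *m (vec v)^T == 0).
Proof.
rewrite /on_conic.
have [c c0 ->] := repr_conic M.
have [d d0 ->] := repr_CP2 v.
have -> : d *: vec v *m (c *: mx M) *m (d *: vec v)^T
    = (d * c * d) *: (vec v *m mx M *m (vec v)^T).
  rewrite [(d *: _)^T]linearZ /= -!scalemxAr -!scalemxAl !scalerA.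
  by congr (_ *: _); ring.
by rewrite scaler_eq0 !mulf_eq0 (negPf c0) (negPf d0).
Qed.

Definition nondegenerate (C : conic) : bool := \det (mx (repr C)) != 0.

Lemma nondegenerateE (M : nonzero symmx) :
  nondegenerate (proj_point M) = (\det (mx M) != 0).
Proof.
rewrite /nondegenerate.
have [c c0 ->] := repr_conic M.
by rewrite detZ mulf_eq0 expf_eq0 (negPf c0).
Qed.

Definition transverse (C D : conic) : Prop :=
  ([set p : CP2 | on_conic C p /\ on_conic D p] #= `I_4)%card.

Definition transverse_pairs : set (conic * conic) :=
  [set x | [/\ nondegenerate x.1, nondegenerate x.2 & transverse x.1 x.2]]%classic.

Lemma congruence_sym_subproof (A : GL3 F) (M : symmx) :
  ((A^T *m M *m A)^T == A^T *m M *m A).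
Proof. by rewrite !trmx_mul trmxK (eqP (valP M)) mulmxA. Qed.

Definition congruence_sym (A : GL3 F) (M : symmx) : symmx :=
  Symmx (congruence_sym_subproof A M).

Lemma congruence_neq0_subproof (A : GL3 F) (M : nonzero symmx) :
  congruence_sym A (val M) != 0.
Proof.
apply: contra (valP M) => /eqP/(congr1 val) AMA0; apply/eqP/val_inj.
have {}AMA0 : A^T *m mx M *m A = 0 by [].
change (mx M = 0); have uA := valP A; have uAT : A^T \in unitmx by rewrite unitmx_tr.
by rewrite -[mx M](mulKmx uAT) -[A^T *m mx M](mulmxK uA) AMA0 mul0mx mulmx0.
Qed.

Definition congruence (A : GL3 F) (M : nonzero symmx) : nonzero symmx :=
  Nonzero (congruence_neq0_subproof A M).

Definition conic_act (A : PGL3 F) (C : conic) : conic :=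
  proj_point (congruence (repr A) (repr C)).

Lemma conic_actE (A : GL3 F) (M : nonzero symmx) :
  conic_act (\pi_(PGL3 F) A) (proj_point M) = proj_point (congruence A M).
Proof.
apply/eqP/proj_pointP.
have [a a0 /= Aa] := repr_PGL3 A.
have [c c0 Mc] := repr_conic M.
exists (a * a * c); first by rewrite !mulf_neq0.
apply/val_inj; rewrite linearZ /=.
change ((repr (\pi_(PGL3 F) A))^T *m mx (repr (proj_point M))
        *m repr (\pi_(PGL3 F) A) = (a * a * c) *: (A^T *m mx M *m A)).
rewrite Mc Aa [(a *: _)^T]linearZ /= -!scalemxAr -!scalemxAl !scalerA.
by congr (_ *: _); ring.
Qed.

Definition pair_act (A : PGL3 F) (x : conic * conic) : conic * conic :=
  (conic_act A x.1, conic_act A x.2).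

Definition equivalent_pairs (x y : conic * conic) : Prop :=
  exists A : PGL3 F, pair_act A x = y.

Lemma conic_act1 (C : conic) : conic_act 1%g C = C.
Proof.
have [M ->] := proj_point_surj C; rewrite conic_actE; congr proj_point.
by apply/val_inj/val_inj => /=; rewrite trmx1 mul1mx mulmx1.
Qed.

(* Congruence is a right action. *)
Lemma conic_actM (A B : PGL3 F) (C : conic) :
  conic_act (A * B)%g C = conic_act B (conic_act A C).
Proof.
rewrite -[A]reprK -[B]reprK; have [M ->] := proj_point_surj C.
rewrite -pi_quotientM (conic_actE _ M) (conic_actE (repr A) M) conic_actE.
congr proj_point.
by apply/val_inj/val_inj => /=; rewrite trmx_mul !mulmxA.
Qed.

Section Isotropy.
Context (x : conic * conic).

Record isotropy := Isotropy {
  isotropy_val :> PGL3 F; _ : pair_act isotropy_val x == x }.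
HB.instance Definition _ := [isSub for isotropy_val].
HB.instance Definition _ := [Choice of isotropy by <:].

Lemma isotropy_closed : group_closed [pred A : PGL3 F | pair_act A x == x].
Proof.
split=> [|A B]; rewrite !inE /pair_act.
  by rewrite !conic_act1 -surjective_pairing.
move=> /eqP Ax /eqP Bx; have {Ax} [Ax1 Ax2] :
  conic_act A x.1 = x.1 /\ conic_act A x.2 = x.2 by rewrite -{2 4}Ax.
have {Bx} [Bx1 Bx2] :
  conic_act B x.1 = x.1 /\ conic_act B x.2 = x.2 by rewrite -{2 4}Bx.
rewrite !conic_actM Ax1 Ax2 -{1}Bx1 -{1}Bx2 -!conic_actM mulgV !conic_act1.
by rewrite -surjective_pairing.
Qed.
HB.instance Definition _ :=
  SubChoice_isSubGroup.Build (PGL3 F) _ isotropy isotropy_closed.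

End Isotropy.

Lemma identity_sym_subproof : (1%:M : 'M[F]_3)^T == 1%:M.
Proof. by rewrite trmx1. Qed.
Lemma identity_neq0_subproof : Symmx identity_sym_subproof != 0.
Proof. by apply/eqP => /(congr1 val)/eqP; rewrite /= oner_eq0. Qed.
Definition identity_conic : conic :=
  proj_point (Nonzero identity_neq0_subproof).

Lemma diag_sym_subproof (l : 'rV[F]_3) : (diag_mx l)^T == diag_mx l.
Proof. by rewrite tr_diag_mx. Qed.
Lemma diag_neq0_subproof (l : nonzero 'rV[F]_3) :
  Symmx (diag_sym_subproof (vec l)) != 0.
Proof.
apply: contra (valP l) => /eqP/(congr1 val)/= l0; apply/eqP/rowP => i.
by move/matrixP/(_ i i): l0; rewrite !mxE eqxx.
Qed.
Definition diag_conic (l : nonzero 'rV[F]_3) : conic :=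
  proj_point (Nonzero (diag_neq0_subproof l)).

Lemma permute_subproof (s : 'S_3) (v : nonzero 'rV[F]_3) :
  col_perm s (vec v) != 0.
Proof.
apply: contra (valP v) => /eqP v0; apply/eqP/rowP => i.
by move/rowP/(_ ((s^-1)%g i)): v0; rewrite !mxE permKV.
Qed.
Definition permute (s : 'S_3) (v : nonzero 'rV[F]_3) : nonzero 'rV[F]_3 :=
  Nonzero (permute_subproof s v).

Definition CP2_perm (s : 'S_3) (p : CP2) : CP2 :=
  proj_point (permute s (repr p)).

Lemma CP2_permE (s : 'S_3) (v : nonzero 'rV[F]_3) :
  CP2_perm s (proj_point v) = proj_point (permute s v).
Proof.
apply/eqP/proj_pointP.
have [c c0 vc] := repr_CP2 v.
by exists c => //=; rewrite vc linearZ.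
Qed.

(* The points of CP^2/S_3 are the orbits. *)
Definition S3_orbit (p : CP2) : set CP2 :=
  [set q | exists s : 'S_3, CP2_perm s p = q]%classic.

End Conics.

Section KleinGroup.
Context (F : fieldType).

Definition sign_row (e : {ffun 'I_3 -> bool}) : 'rV[F]_3 := \row_i (-1) ^+ e i.

Definition is_sign_diag := [pred A : GL3 F |
  [exists e : {ffun 'I_3 -> bool}, val A == diag_mx (sign_row e)]].

Record sign_diag := SignDiag {
  sign_diag_val :> GL3 F; _ : is_sign_diag sign_diag_val }.
HB.instance Definition _ := [isSub for sign_diag_val].
HB.instance Definition _ := [Choice of sign_diag by <:].

Lemma sign_diag_mulVmx (e : {ffun 'I_3 -> bool}) :
  diag_mx (sign_row e) *m diag_mx (sign_row e) = 1%:M.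
Proof.
rewrite mulmx_diag -diag_const_mx; congr diag_mx; apply/rowP => i.
by rewrite !mxE -expr2 sqrr_sign.
Qed.

Lemma sign_diag_closed : group_closed is_sign_diag.
Proof.
split=> [|A B].
  apply/existsP; exists [ffun=> false]; apply/eqP.
  rewrite /= -diag_const_mx; congr diag_mx; apply/rowP => i.
  by rewrite !mxE ffunE expr0.
move=> /existsP[e /eqP Ae] /existsP[f /eqP Bf].
apply/existsP; exists [ffun i => e i (+) f i]; apply/eqP => /=.
have -> : invmx B = diag_mx (sign_row f).
  apply: (can_inj (mulKmx (valP B))); rewrite mulmxV ?(valP B) //.
  by rewrite {1}Bf sign_diag_mulVmx.
rewrite [X in X *m _]Ae mulmx_diag; congr diag_mx; apply/rowP => i.
by rewrite !mxE ffunE signr_addb.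
Qed.
HB.instance Definition _ :=
  SubChoice_isSubGroup.Build (GL3 F) _ sign_diag sign_diag_closed.

Definition is_pm1 := [pred A : sign_diag |
  (GL3_val A == 1%:M) || (GL3_val A == - 1%:M)].

Lemma is_pm1P (A : sign_diag) :
  reflect (exists b : bool, GL3_val A = (-1) ^+ b *: 1%:M) (A \in is_pm1).
Proof.
apply: (iffP orP) => [[/eqP->|/eqP->]|[[] ->]].
- by exists false; rewrite expr0 scale1r.
- by exists true; rewrite expr1 scaleN1r.
- by right; rewrite expr1 scaleN1r.
- by left; rewrite expr0 scale1r.
Qed.

Lemma is_pm1_closed : group_closed is_pm1.
Proof.
split=> [|A B]; first by rewrite inE /= eqxx.
move=> /is_pm1P[a Aa] /is_pm1P[b Bb]; apply/is_pm1P; exists (a (+) b).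
have -> : GL3_val (A / B)%g = A *m invmx B by [].
by rewrite Aa Bb !scalemx1 invmx_scalar -scalar_mxM invr_sign signr_addb.
Qed.

Lemma is_pm1_conj (A B : sign_diag) : A \in is_pm1 -> (A ^ B)%g \in is_pm1.
Proof.
move=> /is_pm1P[a Aa]; apply/is_pm1P; exists a.
have -> : GL3_val (A ^ B)%g = invmx B *m (A *m B) by [].
by rewrite Aa -scalemxAl mul1mx -scalemxAr mulVmx ?(valP (val B)).
Qed.

Definition V4 := quotient_group (NormalSubgroup is_pm1_closed is_pm1_conj).
HB.instance Definition _ := Group.on V4.
HB.instance Definition _ := EqQuotient.on V4.

End KleinGroup.

(* The indices 1, 2, 3 are 0, 1, 2 in ['I_3]; [cycle123] is i |-> i + 1 mod 3. *)
Definition cycle123 : 'S_3 := perm (@addIr _ (1 : 'I_3)).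
Definition cycle132 : 'S_3 := (cycle123^-1)%g.

Definition is_Z3 := [pred s : 'S_3 | s \in [:: 1%g; cycle123; cycle132]].

Record Z3 := MkZ3 { Z3_val :> 'S_3; _ : is_Z3 Z3_val }.
HB.instance Definition _ := [isSub for Z3_val].
HB.instance Definition _ := [Choice of Z3 by <:].

Lemma cycle123E (i : 'I_3) : cycle123 i = i + 1.
Proof. by rewrite permE. Qed.

Lemma cycle123_sqr : (cycle123 * cycle123 = cycle132)%g.
Proof.
apply: (mulIg cycle123); rewrite mulVg; apply/permP => i.
by rewrite !permM perm1 !cycle123E -!addrA -[RHS]addr0; congr (_ + _); apply/val_inj.
Qed.

Lemma is_Z3P (s : 'S_3) :
  reflect (exists n, s = (cycle123 ^+ n)%g) (s \in is_Z3).
Proof.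
have c3 : (cycle123 ^+ 3 = 1)%g by rewrite !expgS mulg1 cycle123_sqr mulgV.
apply: (iffP idP) => [|[n ->]].
  rewrite !inE => /or3P[] /eqP->; first by exists 0%N.
    by exists 1%N.
  by exists 2%N; rewrite -cycle123_sqr.
rewrite (divn_eq n 3) expgnDr mulnC expgnA c3 expg1n mul1g !inE.
have : (n %% 3 < 3)%N by rewrite ltn_mod.
case: (n %% 3)%N => [|[|[|]]] //= _; rewrite ?expg0 ?expg1 ?eqxx ?orbT //.
by rewrite expgS expg1 cycle123_sqr eqxx !orbT.
Qed.

Lemma Z3_comm (s t : Z3) : (val s * val t = val t * val s)%g.
Proof.
case: s t => [s s3] [t t3] /=.
have /is_Z3P[m ->] := s3; have /is_Z3P[n ->] := t3.
by rewrite -!expgnDr addnC.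
Qed.

Lemma is_Z3_closed : group_closed is_Z3.
Proof.
split=> [|s t /is_Z3P[m ->] /is_Z3P[n ->]]; first by rewrite inE /= inE eqxx.
apply/is_Z3P; exists (m + n.*2)%N.
have cV : (cycle123^-1 = cycle123 ^+ 2)%g by rewrite expg2 cycle123_sqr.
by rewrite -expVgn cV -expgnA mul2n expgnDr.
Qed.
HB.instance Definition _ :=
  SubChoice_isSubGroup.Build 'S_3 _ Z3 is_Z3_closed.

Section SemidirectProduct.
Context (F : fieldType).

Definition permute_diag (s : 'S_3) (A : 'M[F]_3) : 'M[F]_3 :=
  diag_mx (\row_i A (s i) (s i)).

Lemma permute_diagM (s : 'S_3) (A B : sign_diag F) :
  permute_diag s (GL3_val A *m GL3_val B)
  = permute_diag s A *m permute_diag s B.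
Proof.
have /existsP[e /eqP/= ->] := valP A; have /existsP[f /eqP/= ->] := valP B.
rewrite /permute_diag !mulmx_diag; congr diag_mx; apply/rowP => i.
by rewrite !mxE eqxx !mulr1n.
Qed.

Lemma permute_diag_sign (s : 'S_3) (A : sign_diag F) :
  exists e : {ffun 'I_3 -> bool}, permute_diag s A = diag_mx (sign_row F e).
Proof.
have /existsP[e /eqP/= ->] := valP A; exists [ffun i => e (s i)].
by congr diag_mx; apply/rowP => i; rewrite !mxE eqxx ffunE mulr1n.
Qed.

Lemma Phi_unit_subproof (s : 'S_3) (A : sign_diag F) :
  permute_diag s A \in unitmx.
Proof.
by have [e ->] := permute_diag_sign s A; case/mulmx1_unit: (sign_diag_mulVmx F e).
Qed.

Lemma Phi_sign_subproof (s : 'S_3) (A : sign_diag F) :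
  is_sign_diag F (MkGL3 (Phi_unit_subproof s A)).
Proof.
by have [e se] := permute_diag_sign s A; apply/existsP; exists e; apply/eqP.
Qed.

Definition Phi_sign (s : Z3) (A : sign_diag F) : sign_diag F :=
  SignDiag (Phi_sign_subproof s A).

Definition Phi (s : Z3) (a : V4 F) : V4 F := \pi_(V4 F) (Phi_sign s (repr a)).

Lemma Phi_signM (s : Z3) : {morph Phi_sign s : A B / (A * B)%g}.
Proof.
move=> A B; do 2 apply/val_inj; exact: permute_diagM.
Qed.

Lemma PhiE (s : Z3) (A : sign_diag F) :
  Phi s (\pi_(V4 F) A) = \pi_(V4 F) (Phi_sign s A).
Proof.
apply/quotient_groupP.
have : repr (\pi_(V4 F) A) = A %[mod V4 F] by rewrite reprK.
move: (repr _) => B /quotient_groupP/is_pm1P[b BA].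
apply/is_pm1P; exists b.
have -> : (Phi_sign s B / Phi_sign s A)%g = Phi_sign s (B / A)%g.
  by apply: (mulIg (Phi_sign s A)); rewrite -Phi_signM !mulgVK.
have -> : GL3_val (Phi_sign s (B / A)%g)
    = permute_diag s (GL3_val (B / A)%g) by [].
rewrite /permute_diag BA scalemx1 -diag_const_mx.
by congr diag_mx; apply/rowP => i; rewrite !mxE eqxx mulr1n.
Qed.

Lemma PhiM (s : Z3) : {morph Phi s : a b / (a * b)%g}.
Proof.
move=> a b; rewrite -[a]reprK -[b]reprK -pi_quotientM !PhiE -pi_quotientM.
by rewrite Phi_signM.
Qed.

Lemma Phi1 (a : V4 F) : Phi 1%g a = a.
Proof.
rewrite -[a]reprK PhiE; congr (\pi_(V4 F) _); do 2 apply/val_inj => /=.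
have /existsP[e /eqP/= ->] := valP (repr a).
by congr diag_mx; apply/rowP => i; rewrite !mxE perm1 eqxx mulr1n.
Qed.

Lemma Phi_comp (s t : Z3) (a : V4 F) : Phi (s * t)%g a = Phi t (Phi s a).
Proof.
rewrite -[a]reprK; move: (repr a) => A.
rewrite (PhiE _ A) (PhiE s A) PhiE; congr (\pi_(V4 F) _).
do 2 apply/val_inj => /=; have /existsP[e /eqP/= ->] := valP A.
congr diag_mx; apply/rowP => i; rewrite !mxE !eqxx !mulr1n.
have := congr1 (fun u : 'S_3 => e (u i)) (Z3_comm s t).
by rewrite [X in _ = X]/= permM [(val t * val s)%g i]permM => ->.
Qed.

Lemma Phi_bij (s : Z3) : bijective (Phi s).
Proof. by exists (Phi s^-1%g) => a; rewrite -Phi_comp ?mulgV ?mulVg Phi1. Qed.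

Definition V4_Phi_Z3 := (V4 F * Z3)%type.
HB.instance Definition _ := Choice.on V4_Phi_Z3.

(* The product of permutations in MathComp is left-to-right composition; this
   makes no difference here since Z_3 is commutative ([Z3_comm]). *)
Definition sdmul (x y : V4_Phi_Z3) : V4_Phi_Z3 :=
  ((Phi y.2 x.1 * y.1)%g, (x.2 * y.2)%g).
Definition sdone : V4_Phi_Z3 := (1%g, 1%g).
Definition sdinv (x : V4_Phi_Z3) : V4_Phi_Z3 :=
  (Phi (x.2^-1)%g (x.1^-1)%g, (x.2^-1)%g).

Let Phi_one s : Phi s 1%g = 1%g.
Proof. by apply: (mulIg (Phi s 1%g)); rewrite -PhiM !mul1g. Qed.

Let sdmulA : associative sdmul.
Proof.
by move=> [a s] [b t] [c u]; congr pair; rewrite /= ?PhiM ?Phi_comp ?mulgA.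
Qed.
Let sdmul1 : left_id sdone sdmul.
Proof. by move=> [a s]; congr pair; rewrite /= ?Phi_one mul1g. Qed.
Let sd1mul : right_id sdone sdmul.
Proof. by move=> [a s]; congr pair; rewrite /= ?Phi1 mulg1. Qed.
Let sdmulV : left_inverse sdone sdinv sdmul.
Proof.
move=> [a s]; congr pair; rewrite /= ?mulVg //.
by rewrite -Phi_comp mulVg Phi1 mulVg.
Qed.
Let sdVmul : right_inverse sdone sdinv sdmul.
Proof.
move=> [a s]; congr pair; rewrite /= ?mulgV //.
by rewrite -PhiM mulgV Phi_one.
Qed.

HB.instance Definition _ :=
  isGroup.Build V4_Phi_Z3 sdmulA sdmul1 sd1mul sdmulV sdVmul.

End SemidirectProduct.

Section Omega.
Context (R : realType).
Local Open Scope complex_scope.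

(* The complex exponential, by Euler's formula. *)
Definition cexp (z : R[i]) : R[i] :=
  (expR (complex.Re z))%:C * (cos (complex.Im z) +i* sin (complex.Im z)).

Definition omega : R[i] := cexp ((2 * trigo.pi / 3)%:C * 'i).

Definition row3 (a b c : R[i]) : 'rV[R[i]]_3 := \row_i [:: a; b; c]`_i.

Lemma omega_row_neq0 : row3 1 omega (omega ^+ 2) != 0.
Proof. by apply/eqP => /rowP/(_ 0)/eqP; rewrite !mxE oner_eq0. Qed.

Definition omega_vec : nonzero 'rV[R[i]]_3 := Nonzero omega_row_neq0.

End Omega.

(* Main.v *)
(* If A^T A = a I and A^T L A = b L with L = diag(l), then A^T = a A^-1 turns the
   second equation into L A = (b/a) A L, so A_ij <> 0 forces l_i = (b/a) l_j.
   When the l_i are distinct (transversality) and non-zero (non-degeneracy), A is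
   therefore a permutation matrix s times a diagonal matrix whose entries all
   square to a, i.e. a sign matrix up to scaling, and l = (b/a) (l o s).  If s is
   not the identity it has no fixed point, hence is a 3-cycle, and l is an
   eigenvector of the cyclic shift, so that [l] is a permutation of
   [1 : omega : omega^2].  Conversely all sign matrices, and for
   (1, omega, omega^2) all 3-cycles as well, preserve the pair. *)
From HB Require Import structures.
Require Import Defs.
From mathcomp Require Import all_boot all_order all_algebra fingroup perm.
From mathcomp Require Import ring lra.
From mathcomp Require Import all_classical all_reals all_analysis.
From mathcomp Require Import complex generic_quotient.

Set Implicit Arguments.
Unset Strict Implicit.
Unset Printing Implicit Defensive.

Import Order.TTheory GRing.Theory Num.Theory.
Local Open Scope quotient_scope.
Local Open Scope ring_scope.

(** * Isotropy groups along an orbit, and stabilizers of diagonal pairs *)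

Section IsotropyGroups.
Context (F : fieldType).
Implicit Types (x y : conic F * conic F) (A B : PGL3 F).

Lemma pair_actM A B x : pair_act (A * B)%g x = pair_act B (pair_act A x).
Proof. by rewrite /pair_act !conic_actM. Qed.

Lemma pair_actK A x : pair_act A^-1%g (pair_act A x) = x.
Proof. by rewrite -pair_actM mulgV /pair_act !conic_act1 -surjective_pairing. Qed.

(** The isomorphism sends an element of the isotropy group to a chosen preimage under [phi];
    injectivity of [phi] makes this choice multiplicative. *)
Lemma isotropy_isomorphic x (H : groupType) (phi : H -> PGL3 F) :
  {morph phi : a b / (a * b)%g} -> injective phi ->
  (forall A, pair_act A x = x <-> exists a, phi a = A) ->
  isomorphic_groups (isotropy x) H.
Proof.
move=> phiM phi_inj phi_im.
have phi_pre (u : isotropy x) : exists a, phi a = val u.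
  by apply/phi_im; exact: (eqP (valP u)).
pose f (u : isotropy x) : H := projT1 (cid (phi_pre u)).
have phif u : phi (f u) = val u by rewrite /f; case: cid.
have fM : {morph f : u v / (u * v)%g}.
  by move=> u v; apply: phi_inj; rewrite phiM !phif.
pose fm := HB.pack_for {multiplicative isotropy x -> H} f
  (isMultiplicative.Build _ _ f fM).
exists fm.
have phiP a : pair_act (phi a) x == x by apply/eqP/phi_im; exists a.
exists (fun a => Isotropy (phiP a)) => [u|a]; first exact/val_inj/phif.
by apply: phi_inj; exact: (phif (Isotropy (phiP a))).
Qed.

(** If [A] carries [x] to [y], then, the action being a right action, the stabilizer of [x] is the
    conjugate [A Stab(y) A^-1]; hence [phi] is conjugated by [A]. *)
Lemma isotropy_isomorphic_equiv x y (H : groupType) (phi : H -> PGL3 F) :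
  equivalent_pairs x y ->
  {morph phi : a b / (a * b)%g} -> injective phi ->
  (forall A, pair_act A y = y <-> exists a, phi a = A) ->
  isomorphic_groups (isotropy x) H.
Proof.
move=> [A Axy] phiM phi_inj phi_im.
apply: (@isotropy_isomorphic _ _ (fun a => A * phi a * A^-1)%g) => [a b|a b|B].
- by rewrite phiM !mulgA mulgVK.
- by move=> /mulIg/mulgI/phi_inj.
have -> : pair_act B x = x <-> pair_act (A^-1 * B * A)%g y = y.
  rewrite !pair_actM -Axy pair_actK; split=> [->//|].
  by move=> /(congr1 (pair_act A^-1%g)); rewrite !pair_actK.
rewrite phi_im; split=> [[a aB]|[a <-]]; exists a.
  by rewrite aB !mulgA mulgV mul1g mulgK.
by rewrite !mulgA mulVg mul1g mulgVK.
Qed.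

Lemma conic_act_fixP (A : GL3 F) (M : nonzero (symmx F)) :
  conic_act (\pi_(PGL3 F) A) (proj_point M) = proj_point M <->
  exists2 c : F, c != 0 & (val A)^T *m mx M *m val A = c *: mx M.
Proof.
rewrite conic_actE; split=> [/eqP/proj_pointP[c c0 /(congr1 val) AMc]|[c c0 AMc]].
  by exists c.
by apply/eqP/proj_pointP; exists c => //; apply/val_inj.
Qed.

Lemma diag_pair_fixP (A : GL3 F) (l : nonzero 'rV[F]_3) :
  let x := (identity_conic F, diag_conic l) in
  pair_act (\pi_(PGL3 F) A) x = x <->
  exists a b : F, [/\ a != 0, b != 0, (val A)^T *m val A = a%:M &
    (val A)^T *m diag_mx (vec l) *m val A = b *: diag_mx (vec l)].
Proof.
have idP := conic_act_fixP A (Nonzero (identity_neq0_subproof F)).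
have diP := conic_act_fixP A (Nonzero (diag_neq0_subproof l)).
rewrite /mx /= in idP diP; rewrite mulmx1 in idP.
split=> [[/idP[a a0 Aa] /diP[b b0 Ab]]|[a [b [a0 b0 Aa Ab]]]].
  by exists a, b; split; rewrite // Aa scalemx1.
rewrite /pair_act; congr pair; first by apply/idP; exists a; rewrite // scalemx1.
by apply/diP; exists b.
Qed.

End IsotropyGroups.

(** * Matrices preserving the identity and a diagonal form up to scalars *)

Section Similitudes.
Context (F : fieldType).
Implicit Types (l d : 'rV[F]_3) (s : 'S_3).

Lemma perm_diagE s d i j : (perm_mx s *m diag_mx d) i j = d 0 j *+ (s i == j).
Proof.
by rewrite mul_mx_diag !mxE eq_sym; case: eqP => _; rewrite ?mul1r ?mul0r.
Qed.

(** Row [k] of the monomial matrix has its only possibly non-zero entry in column [s k], so only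
    [k = s^-1 i] contributes to entry [(i, j)]. The constant row [l = 1] gives the plain Gram
    matrix. *)
Lemma perm_diag_gram s d l :
  (perm_mx s *m diag_mx d)^T *m diag_mx l *m (perm_mx s *m diag_mx d)
  = diag_mx (\row_j (d 0 j ^+ 2 * l 0 ((s^-1)%g j))).
Proof.
apply/matrixP => i j; rewrite [RHS]mxE mxE mul_mx_diag.
under eq_bigr => k _.
  rewrite [X in X * _]mxE [X in X * _ * _]mxE !perm_diagE; over.
rewrite (bigD1 ((s^-1)%g i)) //= big1 ?addr0 => [|k /eqP ki].
  rewrite permKV eqxx mxE; case: (i =P j) => [->|]; rewrite ?mulr0 // !mulr1n; ring.
case: eqP => [ski|_]; last by rewrite !mul0r.
by case: ki; rewrite -ski permK.
Qed.

Lemma unitmx_similitude (A : 'M[F]_3) a :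
  A^T *m A = a%:M -> a != 0 -> A *m A^T = a%:M.
Proof.
move=> Aa a0; have AaV : a^-1 *: A^T *m A = 1%:M.
  by rewrite -scalemxAl Aa scale_scalar_mx mulVf.
by rewrite -[LHS]scale1r -(mulfV a0) -scalerA scalemxAr (mulmx1C AaV) scalemx1.
Qed.

Lemma similitude_monomial l (A : 'M[F]_3) a b :
  injective (l 0) -> a != 0 -> b != 0 ->
  A^T *m A = a%:M -> A^T *m diag_mx l *m A = b *: diag_mx l ->
  exists (s : 'S_3) (k : F) (e : {ffun 'I_3 -> bool}),
    [/\ k != 0, A = k *: (perm_mx s *m diag_mx (sign_row F e)) &
        forall i, l 0 i = b / a * l 0 (s i)].
Proof.
move=> l_inj a0 b0 Aa Ab.
have AA := unitmx_similitude Aa a0.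
have lA i j : A i j != 0 -> l 0 i = b / a * l 0 j.
  move=> Aij; have := congr1 (fun B => (A *m B) i j) Ab.
  rewrite !mulmxA AA mul_scalar_mx -scalemxAl -scalemxAr mul_diag_mx mul_mx_diag.
  rewrite !mxE => E; apply: (mulfI a0); apply: (mulfI Aij).
  rewrite [X in X = _]mulrCA [A i j * l 0 i]mulrC E; field; exact: a0.
have c0 : b / a != 0 by rewrite mulf_neq0 ?invr_eq0.
(* A zero row [i] would make the [(i, i)] entry of [A A^T], which is [a], vanish. *)
have ex_s i : exists j, A i j != 0.
  apply: contrapT => noj; case/eqP: a0; have := congr1 (fun B : 'M[F]_3 => B i i) AA.
  rewrite [RHS]mxE eqxx mulr1n mxE big1 => [<- //|j _].
  have [->|Aij] := eqVneq (A i j) 0; first by rewrite mul0r.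
  by case: noj; exists j.
pose s0 i := xchoose (ex_s i); have s0P i : A i (s0 i) != 0 := xchooseP (ex_s i).
have s0_inj : injective s0.
  by move=> i j ij; apply: l_inj; rewrite (lA _ _ (s0P i)) (lA _ _ (s0P j)) ij.
pose s := perm s0_inj.
(* A second non-zero entry in row [i] would, after cancelling [b / a], give two equal coordinates of
   [l]. *)
have As i j : s i != j -> A i j = 0.
  rewrite permE => /eqP sij; apply/eqP; apply: contra_notT sij => Aij.
  by apply/l_inj/(mulfI c0); rewrite -(lA _ _ (s0P i)) -(lA _ _ Aij).
pose d : 'rV[F]_3 := \row_j A ((s^-1)%g j) j.
have Ad : A = perm_mx s *m diag_mx d.
  apply/matrixP => i j; rewrite perm_diagE.
  by case: eqP => [<-|/eqP/As->]; rewrite ?mxE ?permK.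
have d2 j : d 0 j ^+ 2 = a.
  have := perm_diag_gram s d (const_mx 1); rewrite -Ad diag_const_mx mulmx1 Aa.
  move=> /(congr1 (fun B : 'M[F]_3 => B j j)); rewrite !mxE eqxx !mulr1n mulr1.
  by move=> ->.
have k0 : d 0 0 != 0 by rewrite -sqrf_eq0 d2.
(* All diagonal entries of [d] have square [a], so each is [d 0 0] or its opposite; the boolean
   records which. *)
exists s, (d 0 0), [ffun j => d 0 j != d 0 0]; split=> //.
  rewrite {1}Ad scalemxAr -linearZ /=; congr (_ *m diag_mx _); apply/rowP => j.
  rewrite [RHS]mxE [sign_row _ _ _ _]mxE ffunE.
  have : d 0 j ^+ 2 == d 0 0 ^+ 2 by rewrite !d2.
  by rewrite eqf_sqr; case: eqP => [->|_ /eqP->];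
    rewrite ?expr0 ?expr1 ?mulr1 ?mulrN1.
by move=> i; apply: lA; rewrite permE.
Qed.

End Similitudes.

(** * [V4] and the semidirect product as subgroups of [PGL3] *)

Section Embeddings.
Context (F : fieldType).
Implicit Types (l : nonzero 'rV[F]_3) (s : 'S_3) (e : {ffun 'I_3 -> bool}).

Definition GL3_perm s : GL3 F := MkGL3 (unitmx_perm F s).

Lemma sign_diag_unitmx e : diag_mx (sign_row F e) \in unitmx.
Proof. by case: (mulmx1_unit (sign_diag_mulVmx F e)). Qed.

Lemma is_sign_diag_of e : is_sign_diag F (MkGL3 (sign_diag_unitmx e)).
Proof. by apply/existsP; exists e. Qed.

Definition sign_diag_of e : sign_diag F := SignDiag (is_sign_diag_of e).

Lemma sign_diagP (A : sign_diag F) : exists e, A = sign_diag_of e.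
Proof.
by have /existsP[e /eqP Ae] := valP A; exists e; do 2 apply/val_inj.
Qed.

Definition V4_PGL3 (a : V4 F) : PGL3 F := \pi_(PGL3 F) (sign_diag_val (repr a)).
(* The inverse makes conjugation by the permutation matrix act on V4 through
   [Phi t] rather than [Phi t^-1]. *)
Definition Z3_PGL3 (t : Z3) : PGL3 F := \pi_(PGL3 F) (GL3_perm (val t)^-1%g).
(** The permutation stands on the left: moving the second permutation leftwards past the first sign
    matrix applies [Phi] to that matrix, exactly as in [sdmul]. *)
Definition V4_Phi_Z3_PGL3 (x : V4_Phi_Z3 F) : PGL3 F :=
  (Z3_PGL3 x.2 * V4_PGL3 x.1)%g.

Lemma PGL3_piM (A B : GL3 F) :
  \pi_(PGL3 F) (A * B)%g = (\pi_(PGL3 F) A * \pi_(PGL3 F) B)%g.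
Proof. exact: pi_quotientM. Qed.

Lemma V4_piM (A B : sign_diag F) :
  \pi_(V4 F) (A * B)%g = (\pi_(V4 F) A * \pi_(V4 F) B)%g.
Proof. exact: pi_quotientM. Qed.

Lemma V4_PGL3E (A : sign_diag F) :
  V4_PGL3 (\pi_(V4 F) A) = \pi_(PGL3 F) (sign_diag_val A).
Proof.
rewrite /V4_PGL3; have : repr (\pi_(V4 F) A) = A %[mod V4 F] by rewrite reprK.
move: (repr _) => B /quotient_groupP/is_pm1P[b BA].
apply/quotient_groupP/is_scalar_mxP; exists ((-1) ^+ b).
by rewrite -scalemx1 -BA.
Qed.

Lemma V4_PGL3M : {morph V4_PGL3 : a b / (a * b)%g}.
Proof.
by move=> a b; rewrite -[a]reprK -[b]reprK -V4_piM !V4_PGL3E -PGL3_piM.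
Qed.

(** A sign matrix that is scalar is [I] or [-I], the scalar being its entry at [(0, 0)]. *)
Lemma V4_PGL3_inj : injective V4_PGL3.
Proof.
move=> a b; rewrite -[a]reprK -[b]reprK !V4_PGL3E; move: (repr a) (repr b) => A B.
move=> /quotient_groupP/is_scalar_mxP[c ABc].
have {}ABc : val (val (A / B)%g) = c%:M by [].
apply/quotient_groupP; have /existsP[e /eqP ABe] := valP (A / B)%g.
apply/is_pm1P; exists (e 0).
have -> : GL3_val (A / B)%g = c%:M by rewrite -ABc.
have := congr1 (fun M : 'M[F]_3 => M 0 0) ABe.
by rewrite ABc !mxE eqxx !mulr1n => ->; rewrite scalemx1.
Qed.

Lemma Z3_PGL3M : {morph Z3_PGL3 : t u / (t * u)%g}.
Proof.
move=> t u; rewrite /Z3_PGL3 -PGL3_piM; congr (\pi_(PGL3 F) _); apply/val_inj.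
by rewrite /= -perm_mxM -invgM Z3_comm.
Qed.

(** Both products are supported on the entries [(i, t^-1 i)]; there the permuted sign is
    [e (t (t^-1 i)) = e i]. *)
Lemma V4_PGL3_Phi (t : Z3) (a : V4 F) :
  (Z3_PGL3 t * V4_PGL3 (Phi t a) = V4_PGL3 a * Z3_PGL3 t)%g.
Proof.
rewrite -[a]reprK PhiE !V4_PGL3E -!PGL3_piM; congr (\pi_(PGL3 F) _).
apply/val_inj => /=; have [e ->] := sign_diagP (repr a).
apply/matrixP => i j; rewrite perm_diagE mul_diag_mx !mxE eqxx mulr1n.
by case: eqP => [<-|_] /=; rewrite ?permKV ?mulr1 ?mulr0.
Qed.

Lemma V4_Phi_Z3_PGL3M : {morph V4_Phi_Z3_PGL3 : x y / (x * y)%g}.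
Proof.
move=> [a t] [b u]; rewrite /V4_Phi_Z3_PGL3 /= Z3_PGL3M V4_PGL3M !mulgA.
by congr (_ * _)%g; rewrite -!mulgA V4_PGL3_Phi.
Qed.

Lemma V4_Phi_Z3_PGL3E (A : sign_diag F) (t : Z3) :
  V4_Phi_Z3_PGL3 (\pi_(V4 F) A, t)
  = \pi_(PGL3 F) (GL3_perm (val t)^-1%g * sign_diag_val A)%g.
Proof. by rewrite /V4_Phi_Z3_PGL3 V4_PGL3E PGL3_piM. Qed.

Lemma V4_Phi_Z3_PGL3_inj : injective V4_Phi_Z3_PGL3.
Proof.
move=> [a t] [b u] ab; have tu : t = u; last first.
  by move: ab; rewrite tu /V4_Phi_Z3_PGL3 => /mulgI/V4_PGL3_inj/= ->.
move: ab; rewrite -[a]reprK -[b]reprK !V4_Phi_Z3_PGL3E.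
have [e ->] := sign_diagP (repr a); have [f ->] := sign_diagP (repr b).
move=> /eqP/PGL3P[c c0] /= ab; apply/val_inj/invg_inj/permP => i.
(* The left side has a sign at [(i, t^-1 i)], so the right side cannot vanish there, which forces
   [u^-1 i = t^-1 i]. *)
have := congr1 (fun M : 'M[F]_3 => M i (((val t)^-1)%g i)) ab.
rewrite [RHS]mxE !perm_diagE eqxx mulr1n !mxE => /eqP.
by case: (_ i =P _) => [->//|_]; rewrite mulr0n mulr0 signr_eq0.
Qed.

(** Signs square to 1, so the identity form is fixed exactly, with factor 1, and the diagonal form
    is multiplied by [c]. *)
Lemma perm_sign_fix (A : GL3 F) l s e c :
  c != 0 -> val A = perm_mx s *m diag_mx (sign_row F e) ->
  (forall i, vec l 0 i = c * vec l 0 (s i)) ->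
  let x := (identity_conic F, diag_conic l) in pair_act (\pi_(PGL3 F) A) x = x.
Proof.
move=> c0 Ase lc; apply/diag_pair_fixP; exists 1, c; rewrite oner_eq0 c0 Ase.
have := perm_diag_gram s (sign_row F e) (const_mx 1).
rewrite diag_const_mx mulmx1 perm_diag_gram => ->; split=> //.
  rewrite -diag_const_mx; congr diag_mx.
  by apply/rowP => i; rewrite !mxE sqrr_sign mulr1.
rewrite -linearZ; congr diag_mx; apply/rowP => i.
by rewrite !mxE sqrr_sign mul1r lc permKV.
Qed.

Lemma fix_perm_sign (A : GL3 F) l :
  injective (vec l 0) ->
  let x := (identity_conic F, diag_conic l) in pair_act (\pi_(PGL3 F) A) x = x ->
  exists s c e, [/\ c != 0, forall i, vec l 0 i = c * vec l 0 (s i) &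
    \pi_(PGL3 F) A = \pi_(PGL3 F) (GL3_perm s * sign_diag_val (sign_diag_of e))%g].
Proof.
move=> l_inj x /diag_pair_fixP[a [b [a0 b0 Aa Ab]]].
have [s [k [e [k0 Ak lc]]]] := similitude_monomial l_inj a0 b0 Aa Ab.
exists s, (b / a), e; split=> //; first by rewrite mulf_neq0 ?invr_eq0.
by apply/eqP/PGL3P; exists k.
Qed.

Lemma isotropy_diag_V4 l :
  injective (vec l 0) ->
  (forall s c, c != 0 -> (forall i, vec l 0 i = c * vec l 0 (s i)) -> s = 1%g) ->
  let x := (identity_conic F, diag_conic l) in
  forall A, pair_act A x = x <-> exists a, V4_PGL3 a = A.
Proof.
move=> l_inj l_stab x A; rewrite -[A]reprK; move: (repr A) => {}A; split.
  move=> /(fix_perm_sign l_inj)[s [c [e [c0 /(l_stab _ _ c0) -> ->]]]].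
  exists (\pi_(V4 F) (sign_diag_of e)); rewrite V4_PGL3E.
  by congr (\pi_(PGL3 F) _); apply/val_inj; rewrite /= perm_mx1 mul1mx.
move=> [a <-]; rewrite -[a]reprK V4_PGL3E; have [e ->] := sign_diagP (repr a).
apply: (@perm_sign_fix _ _ 1%g e 1); rewrite ?oner_eq0 //.
  by rewrite perm_mx1 mul1mx.
by move=> i; rewrite perm1 mul1r.
Qed.

Lemma isotropy_diag_V4_Phi_Z3 l :
  injective (vec l 0) ->
  (forall s, s \in is_Z3 <->
    exists2 c, c != 0 & forall i, vec l 0 i = c * vec l 0 (s i)) ->
  let x := (identity_conic F, diag_conic l) in
  forall A, pair_act A x = x <-> exists y, V4_Phi_Z3_PGL3 y = A.
Proof.
move=> l_inj l_stab x A; rewrite -[A]reprK; move: (repr A) => {}A; split.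
  move=> /(fix_perm_sign l_inj)[s [c [e [c0 lc ->]]]].
  have s3 : is_Z3 s by apply/l_stab; exists c.
  (* The inverse compensates for the one built into [Z3_PGL3]. *)
  exists (\pi_(V4 F) (sign_diag_of e), (MkZ3 s3)^-1%g).
  by rewrite V4_Phi_Z3_PGL3E /= invgK.
move=> [[a t] <-]; rewrite -[a]reprK V4_Phi_Z3_PGL3E.
have [e ->] := sign_diagP (repr a).
have /l_stab[c c0 lc] : ((val t)^-1)%g \in is_Z3 by exact: (valP (t^-1)%g).
exact: (perm_sign_fix c0 _ lc).
Qed.

End Embeddings.

(** * Bijections and cardinalities *)

Lemma inj_surj_bijective (T U : Type) (f : T -> U) :
  injective f -> (forall y, exists x, f x = y) -> bijective f.
Proof.
move=> f_inj f_surj; have g y : {x | f x = y} := cid (f_surj y).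
exists (fun y => projT1 (g y)) => [x|y]; last by case: (g y).
by case: (g (f x)) => x' /= /f_inj.
Qed.

Lemma bijective_card_eq (T U : Type) (f : T -> U) :
  bijective f -> ([set: T] #= [set: U])%card.
Proof.
move=> [g fK gK]; have <- : (f @` [set: T])%classic = [set: U]%classic.
  by apply/seteqP; split=> // y _; exists (g y).
by apply/card_esym/inj_card_eq => x y _ _; apply: can_inj fK x y.
Qed.

Lemma card_setT_finType (T : finType) : ([set: T] #= `I_#|T|)%card.
Proof.
apply: card_eq_trans (card_esym card_II); apply: bijective_card_eq.
exact: enum_rank_bij.
Qed.

(** * Permutations and sums over three indices *)

Section ThreeIndices.

Lemma I3_ind (P : 'I_3 -> Prop) : P 0 -> P 1 -> P (1 + 1) -> forall i, P i.
Proof.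
by move=> P0 P1 P2 [[|[|[|]]] // i3]; [move: P0|move: P1|move: P2];
  congr P; apply/val_inj.
Qed.

Lemma cycle132E i : cycle132 i = i + 1 + 1.
Proof.
apply: (@perm_inj _ cycle123); rewrite permKV cycle123E.
by elim/I3_ind: i; apply/val_inj.
Qed.

(** A finite check on the three values of [s]: distinctness and the absence of fixed points leave
    only two triples. *)
Lemma fixpoint_free_cycle (s : 'S_3) :
  (forall i, s i != i) -> s = cycle123 \/ s = cycle132.
Proof.
move=> s_free; have s_inj (i j : 'I_3) : i != j -> val (s i) != val (s j).
  by apply: contra => /eqP/val_inj/perm_inj/eqP.
have s01 := s_inj 0 1 isT; have s02 := s_inj 0 (1 + 1) isT.
have s12 := s_inj 1 (1 + 1) isT.
have s0 : val (s 0) != 0%N by exact: s_free.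
have s1 : val (s 1) != 1%N by exact: s_free.
have s2 : val (s (1 + 1)) != 2%N by exact: s_free.
have [[l0 l1] l2] := (ltn_ord (s 0), ltn_ord (s 1), ltn_ord (s (1 + 1))).
have [[e0 e1 e2]|[e0 e1 e2]] :
    [/\ val (s 0) = 1%N, val (s 1) = 2%N & val (s (1 + 1)) = 0%N] \/
    [/\ val (s 0) = 2%N, val (s 1) = 0%N & val (s (1 + 1)) = 1%N].
- move: s01 s02 s12 s0 s1 s2 l0 l1 l2 => /=.
  move: (nat_of_ord _) (nat_of_ord _) (nat_of_ord _) => a b c.
  by case: a b c => [|[|[|?]]] [|[|[|?]]] [|[|[|?]]] //=; [left|right].
- left; apply/permP; elim/I3_ind; rewrite cycle123E; apply/val_inj;
    by rewrite ?e0 ?e1 ?e2.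
- right; apply/permP; elim/I3_ind; rewrite cycle132E; apply/val_inj;
    by rewrite ?e0 ?e1 ?e2.
Qed.

(** The cyclic group acts simply transitively on the indices; this counts [Z3] as three elements. *)
Lemma Z3_at0_bijective : bijective (fun t : Z3 => val t 0).
Proof.
have c1 : is_Z3 cycle123 by rewrite /= !inE eqxx orbT.
have c2 : is_Z3 cycle132 by rewrite /= !inE eqxx !orbT.
have val0 : [/\ (1 : 'S_3)%g 0 = 0, cycle123 0 = 1 & cycle132 0 = 1 + 1].
  by rewrite perm1 cycle123E cycle132E !add0r.
apply: inj_surj_bijective => [[s s3] [t t3] /= st0|].
  apply/val_inj => /=; move: val0 (s3) (t3) st0 => [v0 v1 v2] /=; rewrite !inE.
  by move=> /or3P[]/eqP-> /or3P[]/eqP-> //; rewrite ?v0 ?v1 ?v2.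
case: val0 => v0 v1 v2; elim/I3_ind.
- by exists 1%g.
- by exists (MkZ3 c1).
- by exists (MkZ3 c2).
Qed.

Lemma I3_third (i j : 'I_3) : i != j -> exists2 k, i != k & j != k.
Proof.
by elim/I3_ind: i; elim/I3_ind: j => // _;
  solve [by exists 0|by exists 1|by exists (1 + 1)].
Qed.

Lemma I3_exhaust (i j k m : 'I_3) :
  i != j -> i != k -> j != k -> [\/ m = i, m = j | m = k].
Proof.
by elim/I3_ind: i; elim/I3_ind: j => //; elim/I3_ind: k => //;
  elim/I3_ind: m => _ _ _; solve [exact: Or31|exact: Or32|exact: Or33].
Qed.

Lemma sum_I3_distinct (V : nmodType) (G : 'I_3 -> V) (i j k : 'I_3) :
  i != j -> i != k -> j != k -> \sum_m G m = G i + (G j + G k).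
Proof.
move=> ij ik jk; rewrite (bigD1 i) //= (bigD1 j) 1?eq_sym //= (bigD1 k) /=.
  rewrite big1 ?addr0 // => m /andP[/andP[mi mj] mk].
  by case: (I3_exhaust m ij ik jk) mi mj mk => ->; rewrite eqxx.
by rewrite eq_sym ik eq_sym jk.
Qed.

End ThreeIndices.

(** * The order of the semidirect product *)

Section Cardinality.
Context (F : numFieldType).

(** Normalizing the first sign to [+1] selects one representative of each class modulo [-I]. *)
Definition V4_elt (b : bool * bool) : V4 F :=
  \pi_(V4 F) (sign_diag_of F [ffun i : 'I_3 => nth false [:: false; b.1; b.2] i]).

Lemma V4_elt_bijective : bijective V4_elt.
Proof.
apply: inj_surj_bijective => [[b1 b2] [c1 c2]|a].
  move=> /(congr1 (@V4_PGL3 F)); rewrite !V4_PGL3E => /eqP/PGL3P[c _] /= bc.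
  have bcE i := congr1 (fun M : 'M[F]_3 => M i i) bc.
  move: (bcE 0) (bcE 1) (bcE (1 + 1)); rewrite !mxE !ffunE /= !mulr1n mulr1.
  by move=> <-; rewrite !mul1r => /signr_inj-> /signr_inj->.
rewrite -[a]reprK; have [e ->] := sign_diagP (repr a).
(* Multiplying the whole sign row by its first sign makes that sign [+1]. *)
exists (e 0 (+) e 1, e 0 (+) e (1 + 1)); apply: (@V4_PGL3_inj F).
rewrite !V4_PGL3E; apply/eqP/PGL3P; exists ((-1) ^+ e 0) => /=.
  by rewrite signr_eq0.
rewrite -linearZ /=; congr diag_mx; apply/rowP; elim/I3_ind.
all: by rewrite !mxE !ffunE /= -signr_addb ?addbb ?addbF ?addKb.
Qed.

Lemma card_V4_Phi_Z3 : ([set: V4_Phi_Z3 F] #= `I_12)%card.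
Proof.
have [f fK Kf] := V4_elt_bijective; have [g gK Kg] := Z3_at0_bijective.
have : bijective (fun y : V4_Phi_Z3 F => (f y.1, val y.2 0)).
  exists (fun z => (V4_elt z.1, g z.2)) => [[a t]|[b i]].
    by congr pair; [exact: Kf|exact: gK].
  by congr pair; [exact: fK|exact: Kg].
move=> /bijective_card_eq/card_eq_trans; apply.
have := card_setT_finType ((bool * bool) * 'I_3)%type.
by rewrite !card_prod card_bool card_ord.
Qed.

End Cardinality.

(** * Rows that a coordinate permutation rescales, and the orbit of the cube roots of unity *)

Section Orbits.
Context (F : fieldType).
Implicit Types (l : nonzero 'rV[F]_3).

Lemma CP2_permM (s t : 'S_3) (p : CP2 F) :
  CP2_perm (s * t)%g p = CP2_perm s (CP2_perm t p).
Proof.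
have [v ->] := proj_point_surj p; rewrite !CP2_permE; congr proj_point.
by apply/val_inj/rowP => i; rewrite /= !mxE permM.
Qed.

Lemma S3_orbit_perm (s : 'S_3) (p : CP2 F) : S3_orbit (CP2_perm s p) = S3_orbit p.
Proof.
apply/seteqP; split=> _ [t <-]; first by exists (t * s)%g; rewrite CP2_permM.
by exists (t * s^-1)%g; rewrite -CP2_permM mulgVK.
Qed.

Lemma cubic_root_unity (c : F) : c ^+ 3 = 1 -> c != 1 -> c ^+ 2 + c + 1 = 0.
Proof.
move=> c3 c1; apply: (@mulfI _ (c - 1)); first by rewrite subr_eq0.
have -> : (c - 1) * (c ^+ 2 + c + 1) = c ^+ 3 - 1 by ring.
by rewrite c3 subrr mulr0.
Qed.

(** Modulo the relations satisfied by [w], the polynomial [X^2 + X + 1] factors as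
    [(X - w) (X - w^2)]. *)
Lemma other_cubic_root (w c : F) :
  w ^+ 3 = 1 -> w != 1 -> c ^+ 3 = 1 -> c != 1 -> c = w \/ c = w ^+ 2.
Proof.
move=> w3 w1 c3 c1; have w0 := cubic_root_unity w3 w1.
have c0 := cubic_root_unity c3 c1.
have /eqP : (c - w) * (c - w ^+ 2) = 0.
  have -> : (c - w) * (c - w ^+ 2)
    = (c ^+ 2 + c + 1) - (w ^+ 2 + w + 1) * c + (w ^+ 3 - 1) by ring.
  by rewrite c0 w0 w3 subrr mul0r subr0 addr0.
by rewrite mulf_eq0 !subr_eq0 => /orP[]/eqP; [left|right].
Qed.

(** Three shifts return to the start, so [c^3 = 1], and distinct coordinates exclude [c = 1]. Hence
    [c] is [w] or [w^2], and [l] is proportional to [(1, w, w^2)] or [(1, w^2, w)]. *)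
Lemma S3_orbit_shift_eigenvector (w c : F) (W l : nonzero 'rV[F]_3) :
  w ^+ 3 = 1 -> w != 1 -> (forall i, vec W 0 i = w ^+ i) ->
  injective (vec l 0) -> vec l 0 0 != 0 ->
  (forall i, vec l 0 (i + 1) = c * vec l 0 i) ->
  S3_orbit (proj_point l) = S3_orbit (proj_point W).
Proof.
move=> w3 w1 WE l_inj l0 lc.
have l1E : vec l 0 1 = c * vec l 0 0 by rewrite -lc add0r.
have l2E : vec l 0 (1 + 1) = c * (c * vec l 0 0) by rewrite lc l1E.
have c3 : c ^+ 3 = 1.
  apply: (mulIf l0); rewrite mul1r -[in RHS](_ : 1 + 1 + 1 = 0 :> 'I_3).
    by rewrite lc l2E !exprS expr0 mulr1 !mulrA.
  exact/val_inj.
have c1 : c != 1.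
  by apply: contra_neq (oner_neq0 'I_3) => c1; apply: l_inj; rewrite l1E c1 mul1r.
have [cw|cw] := other_cubic_root w3 w1 c3 c1.
  suff -> : proj_point l = proj_point W by [].
  apply/eqP/proj_pointP; exists (vec l 0 0) => //; apply/rowP => i.
  rewrite [RHS]mxE -!/(vec _) WE; elim/I3_ind: i => /=.
  - by rewrite expr0 mulr1.
  - by rewrite l1E cw mulrC.
  - by rewrite l2E cw expr2; ring.
(* Here [l] is proportional to [(1, w^2, w)], and swapping the last two coordinates gives [W]. *)
have -> : proj_point l = CP2_perm (tperm 1 (1 + 1)) (proj_point W).
  rewrite CP2_permE; apply/eqP/proj_pointP; exists (vec l 0 0) => //.
  apply/rowP => i; rewrite /= !mxE -!/(vec _) WE; elim/I3_ind: i.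
  - by rewrite tpermD //= expr0 mulr1.
  - by rewrite tpermL l1E cw mulrC.
  - rewrite tpermR l2E cw /= expr1; have -> : w ^+ 2 * (w ^+ 2 * vec l 0 0)
      = w ^+ 3 * (vec l 0 0 * w) by ring.
    by rewrite w3 mul1r.
exact: S3_orbit_perm.
Qed.

(** At a fixed point of [s] the non-zero coordinate forces [c = 1]; distinct coordinates then force
    [s] to be the identity. *)
Lemma scaling_perm_fixfree (l : 'rV[F]_3) (s : 'S_3) c :
  injective (l 0) -> (forall i, l 0 i != 0) ->
  (forall i, l 0 i = c * l 0 (s i)) -> s != 1%g ->
  s = cycle123 \/ s = cycle132.
Proof.
move=> l_inj l0 lc s1; apply: fixpoint_free_cycle => i.
apply: contra_neq s1 => si; have c1 : c = 1.
  by apply: (mulIf (l0 i)); rewrite mul1r [RHS]lc si.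
by apply/permP => j; rewrite perm1; apply: l_inj; rewrite [RHS]lc c1 mul1r.
Qed.

Lemma S3_orbit_scaling (w : F) (W l : nonzero 'rV[F]_3) (s : 'S_3) c :
  w ^+ 3 = 1 -> w != 1 -> (forall i, vec W 0 i = w ^+ i) ->
  injective (vec l 0) -> (forall i, vec l 0 i != 0) ->
  c != 0 -> (forall i, vec l 0 i = c * vec l 0 (s i)) -> s != 1%g ->
  S3_orbit (proj_point l) = S3_orbit (proj_point W).
Proof.
move=> w3 w1 WE l_inj l0 c0 lc s1.
have [sE|sE] := scaling_perm_fixfree l_inj l0 lc s1.
- apply: (S3_orbit_shift_eigenvector (c := c^-1) w3 w1 WE) => // i.
  by rewrite [in RHS]lc mulKf // sE cycle123E.
(* For the inverse cycle, [l (i + 1) = c l (i + 3)], and [i + 3 = i] in ['I_3]. *)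
- apply: (S3_orbit_shift_eigenvector (c := c) w3 w1 WE) => // i.
  rewrite lc sE cycle132E -!addrA; congr (c * vec l 0 _).
  by rewrite -[RHS]addr0; congr (_ + _); apply/val_inj.
Qed.

Lemma powers_scalingP (w : F) (W : nonzero 'rV[F]_3) :
  w ^+ 3 = 1 -> w != 1 -> (forall i, vec W 0 i = w ^+ i) ->
  [/\ injective (vec W 0), forall i, vec W 0 i != 0 & forall s, s \in is_Z3 <->
    exists2 c, c != 0 & forall i, vec W 0 i = c * vec W 0 (s i)].
Proof.
move=> w3 w1 WE.
have w0 : w != 0 by apply: contra_eq_neq w3 => ->; rewrite expr0n eq_sym oner_eq0.
have W0 i : vec W 0 i != 0 by rewrite WE expf_neq0.
have W_inj : injective (vec W 0).
  have ww : w ^+ 2 != w.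
    by rewrite expr2 -subr_eq0 -{3}[w]mulr1 -mulrBr mulf_neq0 // subr_eq0.
  have w2 : w ^+ 2 != 1.
    by apply: contra_neq w1 => w2; rewrite -w3 exprS w2 mulr1.
  elim/I3_ind; elim/I3_ind => //; rewrite !WE /= ?expr0 ?expr1 => /eqP;
    by rewrite ?(negPf ww) ?(negPf w2) ?(negPf w1) // eq_sym
      ?(negPf ww) ?(negPf w2) ?(negPf w1).
split=> // s; split=> [/is_Z3P[n ->]|[c c0 Wc]].
  (* Each shift multiplies [W] by [w], so [n] shifts are undone by the factor [w^-n]. *)
  exists (w^-1 ^+ n) => [|i]; first by rewrite expf_neq0 ?invr_eq0.
  elim: n => [|n IHn] in i *; first by rewrite mul1r perm1.
  rewrite expgSr permM cycle123E IHn exprSr -mulrA; congr (_ * _).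
  (* What remains is [w w^j = w^(j + 1)] with indices modulo 3; the wrap-around at [j = 2] is
     [w^3 = 1]. *)
  apply: (mulfI w0); rewrite mulVKf //.
  move: (_ i) => {IHn} j; elim/I3_ind: j.
  - by rewrite !WE /= expr1 mulr1.
  - by rewrite !WE.
  - by rewrite !WE -[RHS]w3.
have [->|s1] := eqVneq s 1%g; first by rewrite inE /= inE eqxx.
by have [->|->] := scaling_perm_fixfree W_inj W0 Wc s1;
  rewrite inE /= !inE eqxx !orbT.
Qed.

End Orbits.

(** * Invariance of transverse pairs, and equations of diagonal conics *)

Section Transversality.
Context (F : fieldType).
Implicit Types (A : GL3 F) (C D : conic F) (p : CP2 F).

Lemma point_act_neq0 A (v : nonzero 'rV[F]_3) : vec v *m (val A)^T != 0.
Proof.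
have uAT : (val A)^T \in unitmx by rewrite unitmx_tr (valP A).
apply: contra (valP v) => /eqP vA; change (vec v == 0).
by rewrite -[vec v](mulmxK uAT) vA mul0mx.
Qed.

(** Points are rows, so [v A^T] is the transpose of the usual image [A v^T]. *)
Definition point_act A p : CP2 F :=
  proj_point (Nonzero (point_act_neq0 A (repr p))).

Lemma point_actE A v :
  point_act A (proj_point v) = proj_point (Nonzero (point_act_neq0 A v)).
Proof.
apply/eqP/proj_pointP; have [c c0 vc] := repr_CP2 v.
by exists c => //=; rewrite vc scalemxAl.
Qed.

Lemma point_actK (A B : GL3 F) : val A *m val B = 1%:M ->
  cancel (point_act A) (point_act B).
Proof.
move=> AB p; have [v ->] := proj_point_surj p; rewrite !point_actE.
congr proj_point; apply/val_inj => /=.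
by rewrite {1}/vec /= -mulmxA -trmx_mul (mulmx1C AB) trmx1 mulmx1.
Qed.

(** Regrouping [v (A^T M A) v^T] as [(v A^T) M (v A^T)^T] moves the action from the conic to the
    point. *)
Lemma on_conic_act A C p :
  on_conic (conic_act (\pi_(PGL3 F) A) C) p = on_conic C (point_act A p).
Proof.
have [M ->] := proj_point_surj C; have [v ->] := proj_point_surj p.
rewrite conic_actE point_actE !on_conicE; congr (_ == 0).
by rewrite /vec /= trmx_mul trmxK !mulmxA.
Qed.

(** The invertible map [point_act A] sends the common points of the transformed conics bijectively
    onto those of [C] and [D]. *)
Lemma transverse_act A C D :
  transverse C D ->
  transverse (conic_act (\pi_(PGL3 F) A) C) (conic_act (\pi_(PGL3 F) A) D).
Proof.
move=> CD4; apply: card_eq_trans CD4.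
have AVK : cancel (point_act A^-1%g) (point_act A).
  by apply: point_actK; rewrite /= mulVmx ?(valP A).
have AKV : cancel (point_act A) (point_act A^-1%g).
  by apply: point_actK; rewrite /= mulmxV ?(valP A).
rewrite -[X in (_ #= X)%card](_ : (point_act A @`
    [set p | on_conic (conic_act (\pi_(PGL3 F) A) C) p /\
             on_conic (conic_act (\pi_(PGL3 F) A) D) p])%classic = _).
  by apply/card_esym/inj_card_eq => p q _ _; apply: can_inj AKV p q.
apply/seteqP; split=> [_ [p pCD <-]|p pCD]; first by rewrite /= -!on_conic_act.
by exists (point_act A^-1%g p); rewrite //= !on_conic_act AVK.
Qed.

Lemma nondegenerate_act A C :
  Defs.nondegenerate C -> Defs.nondegenerate (conic_act (\pi_(PGL3 F) A) C).
Proof.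
have [M ->] := proj_point_surj C; rewrite conic_actE !nondegenerateE => M0.
have : \det (val A) != 0 by rewrite -unitfE -unitmxE (valP A).
by move=> A0; rewrite /mx /= !det_mulmx det_tr !mulf_neq0.
Qed.

Lemma transverse_pairs_act (B : PGL3 F) x :
  transverse_pairs x -> transverse_pairs (pair_act B x).
Proof.
rewrite -[B]reprK; move=> [x1 x2 x12].
by split; [exact: nondegenerate_act|exact: nondegenerate_act|exact: transverse_act].
Qed.

Lemma nondegenerate_diag (l : nonzero 'rV[F]_3) i :
  Defs.nondegenerate (diag_conic l) -> vec l 0 i != 0.
Proof.
rewrite nondegenerateE /mx /= det_diag; apply: contra => /eqP li.
by rewrite (bigD1 i) //= -/(vec l) li mul0r.
Qed.

Lemma on_diag_conic (l v : nonzero 'rV[F]_3) :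
  on_conic (diag_conic l) (proj_point v)
  = (\sum_i vec l 0 i * vec v 0 i ^+ 2 == 0).
Proof.
rewrite on_conicE; set S := \sum_i _.
have -> : vec v *m mx (Nonzero (diag_neq0_subproof l)) *m (vec v)^T = S%:M.
  apply/matrixP => i j; rewrite !ord1 mul_mx_diag !mxE eqxx mulr1n.
  by apply: eq_bigr => k _; rewrite !mxE -/(vec l); ring.
by rewrite -scalemx1 scaler_eq0 oner_eq0 orbF.
Qed.

Lemma on_identity_conic (v : nonzero 'rV[F]_3) :
  on_conic (identity_conic F) (proj_point v) = (\sum_i vec v 0 i ^+ 2 == 0).
Proof.
rewrite on_conicE; set S := \sum_i _.
have -> : vec v *m mx (Nonzero (identity_neq0_subproof F)) *m (vec v)^T = S%:M.
  apply/matrixP => i j; rewrite !ord1 mulmx1 !mxE eqxx mulr1n.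
  by apply: eq_bigr => k _; rewrite !mxE.
by rewrite -scalemx1 scaler_eq0 oner_eq0 orbF.
Qed.

End Transversality.

(** * Transversality forces distinct diagonal entries *)

Section DistinctEigenvalues.
Context (F : numFieldType) (ii : F) (ii2 : ii ^+ 2 = -1).
Implicit Types (l v : nonzero 'rV[F]_3).

(* Rational parametrization of x^2 + y^2 + z^2 = 0; the parameter is recovered
   from the homogeneous coordinates as y / (x - ii z). *)
Definition conic_row (t : F) : 'rV[F]_3 :=
  \row_i [:: 1 - t ^+ 2; t *+ 2; ii * (1 + t ^+ 2)]`_i.

(** The constancy of this linear form shows that the row is non-zero and that two proportional rows
    of the family have ratio 1, whence injectivity. *)
Lemma conic_row_sub t : conic_row t 0 0 - ii * conic_row t 0 (1 + 1) = 2.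
Proof.
rewrite !mxE /=; have -> : 1 - t ^+ 2 - ii * (ii * (1 + t ^+ 2))
  = 1 - t ^+ 2 - ii ^+ 2 * (1 + t ^+ 2) by ring.
by rewrite ii2; ring.
Qed.

Lemma conic_row_neq0 t : conic_row t != 0.
Proof.
apply/eqP => t0; have := conic_row_sub t; rewrite t0 !mxE mulr0 subr0.
by move/eqP; rewrite eq_sym pnatr_eq0.
Qed.

Definition conic_point (t : F) : CP2 F := proj_point (Nonzero (conic_row_neq0 t)).

Lemma conic_point_inj : injective conic_point.
Proof.
move=> s t /eqP/proj_pointP[c c0 /= st].
have stE i : conic_row s 0 i = c * conic_row t 0 i by rewrite st mxE.
have n2 : (2 : F) != 0 by rewrite pnatr_eq0.
have c1 : c = 1.
  apply: (mulIf n2); rewrite mul1r -{1}(conic_row_sub t) -(conic_row_sub s) !stE.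
  by ring.
have := stE 1; rewrite c1 mul1r !mxE /= -[s *+ 2]mulr_natr -[t *+ 2]mulr_natr.
exact: mulIf.
Qed.

(** With a repeated entry the two conics either coincide or meet in at most two points, so they
    never have exactly four common points. *)
Lemma transverse_distinct l :
  transverse (identity_conic F) (diag_conic l) -> injective (vec l 0).
Proof.
move=> l4 i j lij; apply: contrapT => /eqP ij.
have [k ik jk] := I3_third ij.
have sumE (G : 'I_3 -> F) := sum_I3_distinct G ij ik jk.
have [lk|lk] := eqVneq (vec l 0 k) (vec l 0 i).
  (* The two conics coincide and have infinitely many points. *)
  have lE m : vec l 0 m = vec l 0 i.
    by have [->|->|->] := I3_exhaust m ij ik jk.
  have onI n : (conic_point n%:R : CP2 F) \in
      [set p | on_conic (identity_conic F) p /\ on_conic (diag_conic l) p]%classic.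
    rewrite inE /= on_identity_conic on_diag_conic.
    under [X in _ /\ is_true (X == _)]eq_bigr do rewrite lE.
    rewrite -mulr_sumr (sum_I3_distinct _ (i := 0) (j := 1) (k := 1 + 1)) //.
    rewrite /vec /= !mxE /= exprMn ii2.
    suff -> : (1 - n%:R ^+ 2) ^+ 2 + ((n%:R *+ 2) ^+ 2 + -1 * (1 + n%:R ^+ 2) ^+ 2)
      = 0 :> F by rewrite mulr0.
    by ring.
  pose f (n : nat) := conic_point n%:R.
  (* Five integer parameters already give more than four common points. *)
  have : (`I_5 #<= `I_4)%card.
    rewrite -(card_le_eqr l4) -(card_le_eql (@inj_card_eq _ _ `I_5%classic f _)).
      by apply: subset_card_le => _ [n _ <-]; have := onI n; rewrite inE.
    by move=> m n _ _ /conic_point_inj/eqP; rewrite eqr_nat => /eqP.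
  by rewrite card_le_II.
(* The common points satisfy x_k = 0 and x_i^2 + x_j^2 = 0: there are only two. *)
pose r (b : bool) : 'rV[F]_3 :=
  \row_m (if m == i then 1 else if m == j then (-1) ^+ b * ii else 0).
have r0 b : r b != 0.
  by apply/eqP => /rowP/(_ i)/eqP; rewrite !mxE eqxx oner_eq0.
pose f b : CP2 F := proj_point (Nonzero (r0 b)).
have : (`I_4 #<= `I_2)%card.
  rewrite -(card_le_eql l4); have := card_setT_finType bool; rewrite card_bool.
  move=> /card_le_eqr <-; apply: card_le_trans (card_image_le f _).
  apply: subset_card_le => p /=; have [v ->] := proj_point_surj p.
  rewrite on_identity_conic on_diag_conic !sumE => -[/eqP v1 /eqP vl].
  have vk : vec v 0 k = 0.
    apply/eqP; rewrite -sqrf_eq0.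
    (* Subtracting [l_i] times the first equation from the second eliminates both [x_i] and [x_j],
       as [l_i = l_j]. *)
    have /eqP : (vec l 0 k - vec l 0 i) * vec v 0 k ^+ 2 = 0.
      transitivity (vec l 0 i * vec v 0 i ^+ 2 +
          (vec l 0 i * vec v 0 j ^+ 2 + vec l 0 k * vec v 0 k ^+ 2)
        - vec l 0 i * (vec v 0 i ^+ 2 + (vec v 0 j ^+ 2 + vec v 0 k ^+ 2))).
        by ring.
      by rewrite {2}lij vl v1 mulr0 subr0.
    by rewrite mulf_eq0 subr_eq0 (negPf lk).
  have vij : vec v 0 j ^+ 2 = (ii * vec v 0 i) ^+ 2.
    rewrite exprMn ii2 mulN1r; apply/eqP; rewrite -addr_eq0.
    by rewrite addrC -v1 vk expr0n /= addr0.
  have [b vj] : exists b : bool, vec v 0 j = (-1) ^+ b * (ii * vec v 0 i).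
    move/eqP: vij; rewrite eqf_sqr => /orP[]/eqP->; [exists false|exists true].
      by rewrite mul1r.
    by rewrite mulN1r.
  (* Otherwise all three homogeneous coordinates would vanish. *)
  have vi : vec v 0 i != 0.
    apply: contra (valP v) => /eqP vi; apply/eqP/rowP => m; rewrite [RHS]mxE.
    change (vec v 0 m = 0).
    by have [->|->|->] := I3_exhaust m ij ik jk; rewrite // vj vi !mulr0.
  exists b => //; apply/esym/eqP/proj_pointP; exists (vec v 0 i) => //.
  apply/rowP => m; change (vec v 0 m = (vec v 0 i *: r b) 0 m); rewrite !mxE.
  have [->|->|->] := I3_exhaust m ij ik jk; rewrite ?eqxx ?mulr1 //.
    by rewrite eq_sym (negPf ij) vj; ring.
  by rewrite eq_sym (negPf ik) eq_sym (negPf jk) mulr0.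
by rewrite card_le_II.
Qed.

End DistinctEigenvalues.

(** * [omega] is a non-trivial cube root of unity *)

Section PrimitiveCubeRoot.
Context (R : realType).
Local Open Scope complex_scope.

Let theta : R := 2 * trigo.pi / 3.

Let omegaE : omega R = cos theta +i* sin theta.
Proof.
rewrite /omega /cexp -/theta.
have -> : theta%:C * 'i = 0 +i* theta.
  by apply/eqP; rewrite eq_complex /= !mulr0 !mul0r mulr1 subrr addr0 !eqxx.
by rewrite /= expR0 mul1r.
Qed.

(** The addition formulas for sine and cosine make arguments add up, and three times [theta] is a
    full turn. *)
Lemma omega_cube : omega R ^+ 3 = 1.
Proof.
rewrite omegaE; have mulE (s t : R) :
    (cos s +i* sin s) * (cos t +i* sin t) = cos (s + t) +i* sin (s + t).
  by apply/eqP; rewrite eq_complex /= cosD sinD eqxx /= [X in X == _]addrC.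
rewrite !exprS expr0 mulr1 !mulE.
have -> : theta + (theta + theta) = trigo.pi *+ 2 by rewrite /theta; field.
by rewrite cos2pi sin2pi.
Qed.

(** The angle [theta] lies strictly between 0 and pi, so the imaginary part is positive. *)
Lemma omega_neq1 : omega R != 1.
Proof.
have pi0 := trigo.pi_gt0 R.
rewrite omegaE eq_complex /= negb_and orbC gt_eqF // sin_gt0_pi //.
by rewrite /theta; lra.
Qed.

Lemma omega_vecE i : vec (omega_vec R) 0 i = omega R ^+ i.
Proof. by rewrite mxE; elim/I3_ind: i; rewrite /= ?expr0 ?expr1. Qed.

End PrimitiveCubeRoot.

Theorem proposition2 (R : realType) :
  (forall (C D : conic R[i]) (lambda : nonzero 'rV[R[i]]_3),
     transverse_pairs (C, D) ->
     equivalent_pairs (C, D) (identity_conic R[i], diag_conic lambda) ->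
     S3_orbit (proj_point lambda) <> S3_orbit (proj_point (omega_vec R)) ->
     isomorphic_groups (isotropy (C, D)) (V4 R[i])) /\
  ([set: isotropy (identity_conic R[i], diag_conic (omega_vec R))]%classic #= `I_12)%card /\
  isomorphic_groups
    (isotropy (identity_conic R[i], diag_conic (omega_vec R)))
    (V4_Phi_Z3 R[i]).
Proof.
have w3 := omega_cube R; have w1 := omega_neq1 R; have wE := @omega_vecE R.
have [w_inj w0 w_stab] := powers_scalingP w3 w1 wE.
have iso12 : isomorphic_groups
    (isotropy (identity_conic R[i], diag_conic (omega_vec R))) (V4_Phi_Z3 R[i]).
  apply: (isotropy_isomorphic (@V4_Phi_Z3_PGL3M _) (@V4_Phi_Z3_PGL3_inj _)).
  exact: isotropy_diag_V4_Phi_Z3.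
split; last first.
  split=> //; have [f /bijective_card_eq/card_eq_trans] := iso12; apply.
  exact: card_V4_Phi_Z3.
move=> C D l tCD eqCD l_omega.
apply: (isotropy_isomorphic_equiv eqCD (@V4_PGL3M _) (@V4_PGL3_inj _)).
(* Non-degeneracy and transversality are transported to the diagonal pair, where they make the
   entries of [l] non-zero and distinct. *)
have [A Al] := eqCD; have := transverse_pairs_act A tCD; rewrite Al => -[/= _ nl tl].
have l_inj := transverse_distinct (sqrCi _) tl.
have l0 i := nondegenerate_diag i nl.
apply: isotropy_diag_V4 => // s c c0 lc.
(* A non-trivial permutation rescaling [l] would put its class in the excluded orbit. *)
apply/eqP; apply: contrapT => /negP s1; apply: l_omega.
exact: S3_orbit_scaling w3 w1 wE l_inj l0 c0 lc s1.
Qed.
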